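(* Let $G$ be a countable amenable group with a left or right Følner sequence $F=(F_N)_{N\in\mathbb{N}}$, let $(X,\mathcal{B},\mu,(T_{(g,h)})_{(g,h)\in G\times G})$ be a measure preserving system and let $Y\in\mathcal{B}$. Then there is $B\subseteq G$ such that $\overline{d}_F(B)\geq\mu(Y)^2$ and $$B\times B\subseteq\{(g,h)\in G\times G:\mu(Y\cap T_{(g,h)}Y)>0\}.$$
   Context: ''Countable'' means in bijective correspondence with $\mathbb{N}$. A left Følner sequence in a countable group $G$ is a sequence $(F_N)_{N\in\mathbb{N}}$ of finite nonempty subsets of $G$ such that $\lim_{N\to\infty}\frac{|gF_N\Delta F_N|}{|F_N|}=0$ for all $g\in G$; it is a right Følner sequence if $\lim_{N\to\infty}\frac{|F_Ng\Delta F_N|}{|F_N|}=0$ for all $g\in G$. $G$ is amenable if it has a left Følner sequence (equivalently, a right one). For a group $K$, a measure preserving system $(X,\mathcal{B},\mu,(T_k)_{k\in K})$ consists of a probability space $(X,\mathcal{B},\mu)$ and a left action of $K$ on $X$ by measure-preserving maps $T_k$, so that $T_{kl}=T_k\circ T_l$. For $E\subseteq G$, $\overline{d}_F(E)=\limsup_{N\to\infty}\frac{|E\cap F_N|}{|F_N|}$. *)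

(* Defs.v *)
From HB Require Import structures.
From mathcomp Require Import all_boot all_order all_algebra finmap.
From mathcomp Require Import all_classical all_reals all_analysis.

Set Implicit Arguments.
Unset Strict Implicit.
Unset Printing Implicit Defensive.

Import Order.TTheory GRing.Theory Num.Theory.
Import numFieldNormedType.Exports.

Local Open Scope classical_set_scope.
Local Open Scope ring_scope.

(* "Countable" is understood as countably infinite. *)
Definition countable_group (G : groupType) : Prop := ([set: G] #= [set: nat])%card.

Definition fset_symdiff (K : choiceType) (A B : {fset K}) : {fset K} :=
  ((A `\` B) `|` (B `\` A))%fset.

Definition left_Folner (R : realType) (G : groupType) (F : nat -> {fset G}) :
    Prop :=
  (forall N, F N != fset0) /\
  (forall g : G,
    (fun N => #|` fset_symdiff [fset (g * x)%g | x in F N]%fset (F N)|%:R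
              / #|` F N|%:R : R) @ \oo --> (0 : R)).

Definition right_Folner (R : realType) (G : groupType) (F : nat -> {fset G}) :
    Prop :=
  (forall N, F N != fset0) /\
  (forall g : G,
    (fun N => #|` fset_symdiff [fset (x * g)%g | x in F N]%fset (F N)|%:R
              / #|` F N|%:R : R) @ \oo --> (0 : R)).

Definition amenable (R : realType) (G : groupType) : Prop :=
  exists F : nat -> {fset G}, left_Folner R F.

Definition upper_density (R : realType) (G : groupType) (F : nat -> {fset G})
    (E : set G) : \bar R :=
  limn_esup (fun N =>
    (#|` [fset x in F N | x \in E]%fset|%:R / #|` F N|%:R)%:E).

Record measure_preserving_action (K : groupType) (d : measure_display)
    (X : measurableType d) (R : realType) (mu : probability X R)
    (T : K -> X -> X) : Prop := MeasurePreservingAction {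
  mpa_one : forall x, T 1%g x = x ;
  mpa_mul : forall k l x, T (k * l)%g x = T k (T l x) ;
  mpa_measurable : forall k, measurable_fun [set: X] (T k) ;
  mpa_preserving : forall k (A : set X), measurable A ->
    mu (T k @^-1` A) = mu A
}.

(* Main.v *)
Require Import Defs.
From HB Require Import structures.
From mathcomp Require Import all_boot all_order all_algebra finmap.
From mathcomp Require Import all_classical all_reals all_analysis.
From mathcomp Require Import measurable_realfun ring lra.
Set Implicit Arguments.
Unset Strict Implicit.
Unset Printing Implicit Defensive.

Import Order.TTheory GRing.Theory Num.Theory.
Import numFieldNormedType.Exports.

Local Open Scope classical_set_scope.
Local Open Scope ring_scope.

(** A correlation over the product group factors through the coordinates: with
    C g h the set of x such that both T (g^-1, 1) x and T (1, h) x are in Y, the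
    measure of C g h is that of the intersection of Y and T (g, h) Y. If x is a
    point outside all the null sets among the countably many C g h, then the set
    B of all g with x in C g g satisfies the required inclusion, since x in C g g
    and x in C h h put x in C g h, which therefore has positive measure.

    It remains to find such an x for which B has upper density at least the
    square of the measure of Y. The proportion of B in F N is the average over F N
    of the indicators of the C g g at x, so by Fatou's lemma
    ([ex_limn_esup_ge], [ex_upper_density_ge]) it suffices that the averages over
    F N of the measures of the C g g have limit superior at least that square.
    These measures are the correlations of Y with its translates under the
    diagonal action g |-> T (g, g) ([diagonal_recurrence]).

    The bound on the averaged correlations would follow from the mean ergodic
    theorem, but a limit superior needs less. Let u_N be the average over F N of
    the indicators of the translates of Y. Almost invariance of F N makes the
    inner product of u_M and u_N close to the averaged correlation over F N as N
    grows with M fixed. If these correlations were eventually at most some b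
    less than the square of the measure of Y, infinitely many u_N could be
    selected with pairwise inner products at most some b' still below that
    square; the mean of k of them would have squared norm at most b' + O(1 / k),
    whereas its integral is the measure of Y ([sum_measureI_ge],
    [average_recurs_above], [averages_recur]). *)

(** * Correlations of sets in a probability space *)

Section weighted_indicators.
Context (R : realType) (d : measure_display) (X : measurableType d)
  (mu : probability X R).

Lemma integrable_weighted_indic (J : Type) (s : seq J) (w : J -> R)
    (E : J -> set X) : (forall j, measurable (E j)) ->
  mu.-integrable setT (EFin \o (fun x => \sum_(j <- s) w j * \1_(E j) x)).
Proof.
move=> mE.
have -> : EFin \o (fun x => \sum_(j <- s) w j * \1_(E j) x) =
    (fun x => \sum_(j <- s) ((w j)%:E * (\1_(E j) x)%:E)%E).
  by apply/funext => x /=; rewrite -sumEFin.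
apply: (integrable_sum measurableT) => j _.
by apply: integrableZl => //; exact: integrable_indic.
Qed.

Lemma Rintegral_weighted_indic (J : Type) (s : seq J) (w : J -> R)
    (E : J -> set X) : (forall j, measurable (E j)) ->
  \int[mu]_x (\sum_(j <- s) w j * \1_(E j) x) =
  \sum_(j <- s) w j * fine (mu (E j)).
Proof.
move=> mE; elim: s => [|j s IHs].
  under eq_Rintegral do rewrite big_nil.
  by rewrite Rintegral_cst// mul0r big_nil.
under eq_Rintegral do rewrite big_cons.
have intj : mu.-integrable setT (EFin \o (\1_(E j) : X -> R)).
  exact: integrable_indic.
rewrite RintegralD//.
- rewrite big_cons IHs RintegralZl//; congr (_ * _ + _).
  by rewrite /Rintegral integral_indic// setIT.
- by apply: (@integrableZl _ _ _ mu _ _ (w j) (EFin \o \1_(E j))).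
- exact: integrable_weighted_indic.
Qed.

(** This is the integral of the square of the sum of the w i times the
    indicator of E i. *)
Lemma sum_measureI_ge0 (J : Type) (s : seq J) (w : J -> R)
    (E : J -> set X) : (forall j, measurable (E j)) ->
  0 <= \sum_(i <- s) \sum_(j <- s) w i * w j * fine (mu (E i `&` E j)).
Proof.
move=> mE.
have -> : \sum_(i <- s) \sum_(j <- s) w i * w j * fine (mu (E i `&` E j)) =
    \int[mu]_x (\sum_(i <- s) w i * \1_(E i) x) ^+ 2.
  have mEE (p : J * J) : measurable (E p.1 `&` E p.2) by exact: measurableI.
  pose ww (p : J * J) := w p.1 * w p.2.
  have := Rintegral_weighted_indic [seq (i, j) | i <- s, j <- s] ww mEE.
  rewrite big_allpairs_dep /= => <-; apply: eq_Rintegral => x _.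
  rewrite big_allpairs_dep /= expr2 mulr_suml; apply: eq_bigr => i _.
  by rewrite mulr_sumr; apply: eq_bigr => j _; rewrite indicI /ww /=; ring.
by apply: Rintegral_ge0 => x _; exact: sqr_ge0.
Qed.

(** Positive semidefiniteness relative to the mean: adjoining the whole space,
    with weight minus the integral of the weighted sum of indicators, centres
    that sum, and its variance is nonnegative. *)
Lemma sum_measureI_ge (J : Type) (s : seq J) (w : J -> R) (E : J -> set X)
    (c : R) : (forall j, measurable (E j)) -> (forall j, fine (mu (E j)) = c) ->
  c ^+ 2 * (\sum_(j <- s) w j) ^+ 2 <=
  \sum_(i <- s) \sum_(j <- s) w i * w j * fine (mu (E i `&` E j)).
Proof.
move=> mE muE; set W := \sum_(j <- s) w j.
pose E' o := if o is Some j then E j else setT.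
pose w' o := if o is Some j then w j else - (c * W).
have mE' o : measurable (E' o).
  by case: o => [j|]; [exact: mE|exact: measurableT].
have := sum_measureI_ge0 (None :: map Some s) w' mE'.
rewrite !big_cons !big_map /= setIT probability_setT /=.
rewrite (eq_bigr (fun j => - (c * W) * c * w j)); last first.
  by move=> j _; rewrite setTI muE; ring.
rewrite -mulr_sumr.
rewrite [X in _ + X](eq_bigr (fun i => - (c * W) * c * w i +
    \sum_(j <- s) w i * w j * fine (mu (E i `&` E j)))); last first.
  by move=> i _; rewrite big_cons big_map /= setIT muE; congr (_ + _); ring.
by rewrite big_split /= -mulr_sumr -/W; lra.
Qed.

End weighted_indicators.

(** * Recurrence of averages *)

(** Read A M N as the inner product of two vectors u_M and u_N of norm at most 1;
    the lower bound on the sums of A says that the mean of any k of these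
    vectors has squared norm at least c. Were L N at most b < c from some point
    on, then each new u_N, taken late enough, would have inner product at most
    (b + c) / 2 with the finitely many vectors chosen before. The sum of A over
    k vectors so chosen would be at most k + (k ^ 2 - k) (b + c) / 2, which is
    less than c k ^ 2 for large k. *)
Lemma average_recurs_above (R : realType) (A : nat -> nat -> R) (L : nat -> R)
    (c : R) :
  (forall M N, A M N = A N M) -> (forall N, A N N <= 1) ->
  (forall s : seq nat,
     c * (size s)%:R ^+ 2 <= \sum_(M <- s) \sum_(N <- s) A M N) ->
  (forall M, A M N - L N @[N --> \oo] --> (0 : R)) ->
  forall (b : R) (n : nat), b < c -> exists2 N, (n <= N)%N & b < L N.
Proof.
move=> Asym Adiag Age AL b n bc; apply: contrapT => /forall2NP noN.
have Lb N : (n <= N)%N -> L N <= b.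
  by move=> nN; case: (noN N) => // /negP; rewrite -leNgt.
(* Half of the gap absorbs the difference between A M N and L N. *)
pose e := (c - b) / 2; have e0 : 0 < e by rewrite /e; lra.
have fresh M : \forall N \near \oo, A M N <= b + e.
  have := AL M => /cvgr0Pnorm_le /(_ _ e0) ALe.
  near=> N.
  have nN : (n <= N)%N by near: N; exists n.
  have : `|A M N - L N| <= e by near: N.
  by rewrite ler_norml => /andP[_]; have := Lb _ nN; lra.
have freshs (s : seq nat) :
    \forall N \near \oo, forall M, M \in s -> A M N <= b + e.
  elim: s => [|M s IHs]; first by near=> N.
  near=> N => M'; rewrite inE => /orP[/eqP ->|M's].
    by near: N; exact: fresh.
  by move: M' M's; near: N; exact: IHs.
have long k : exists2 s : seq nat, size s = k &
    \sum_(M <- s) \sum_(N <- s) A M N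
      <= k%:R + (k%:R ^+ 2 - k%:R) * (b + e).
  elim: k => [|k [s sk IHs]].
    by exists [::] => //; rewrite big_nil expr0n /=; lra.
  have [N /= sN] := filter_ex (freshs s).
  exists (N :: s); first by rewrite /= sk.
  have row : \sum_(M <- s) A M N <= k%:R * (b + e).
    rewrite -sk mulr_natl -(count_predT s) -iter_addr_0 -big_const_seq.
    by rewrite big_seq [leRHS]big_seq; apply: ler_sum => M; exact: sN.
  rewrite big_cons big_cons (eq_bigr _ (fun M _ => big_cons _ _ _ _ _ _)) /=.
  rewrite big_split /= (eq_bigr (fun M => A M N) (fun M _ => Asym N M)).
  by have := Adiag N; rewrite -natr1; move: row IHs; lra.
have [k bigk] : exists k : nat, (1 - (b + e)) / e < k%:R.
  exists (Num.bound `|(1 - (b + e)) / e|).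
  exact: le_lt_trans (ler_norm _) (archi_boundP (normr_ge0 _)).
have [s sk sle] := long k.+1.
have := le_trans (Age s) sle; rewrite sk => key.
have k1 : 0 < k.+1%:R :> R by rewrite ltr0n.
move: bigk; rewrite ltr_pdivrMr// => bigk.
have : k.+1%:R * (k.+1%:R * (c - (b + e)) - (1 - (b + e))) <= 0 by lra.
rewrite pmulr_rle0// -natr1.
have -> : c - (b + e) = e by rewrite /e; lra.
by lra.
Unshelve. all: by end_near. Qed.

(** The averages of a stay close to those of the correlations of any fixed E j,
    so the Gram matrix argument applies to the averages over F N of the
    indicators of the E i, all of mean c: their inner products A M N are close
    to the average of a for N large. *)
Lemma averages_recur (R : realType) (d : measure_display)
    (X : measurableType d) (mu : probability X R) (I : choiceType)
    (F : nat -> {fset I}) (E : I -> set X) (a : I -> R) (c : R) :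
  (forall N, F N != fset0) -> (forall i, measurable (E i)) ->
  (forall i, fine (mu (E i)) = c) ->
  (forall j, (\sum_(i <- F N) fine (mu (E j `&` E i))) / #|` F N|%:R
             - (\sum_(i <- F N) a i) / #|` F N|%:R @[N --> \oo] --> (0 : R)) ->
  forall (b : R) (n : nat), b < c ^+ 2 ->
  exists2 N, (n <= N)%N & b < (\sum_(i <- F N) a i) / #|` F N|%:R.
Proof.
move=> F0 mE muE shift.
have cardF0 N : 0 < #|` F N|%:R :> R by rewrite ltr0n cardfs_gt0.
pose K j i := fine (mu (E j `&` E i)).
have K1 j i : K j i <= 1.
  rewrite /K -[leRHS]/(fine 1%E) fine_le ?probability_le1 ?fin_num_measure//.
    exact: measurableI.
  exact: measurableI.
have avg1 N : \sum_(i <- F N) #|` F N|%:R^-1 = 1 :> R.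
  by rewrite big_const_seq count_predT iter_addr_0 -[X in X *+ _]mulr1 -mulrnAr
    mulVf// gt_eqF.
pose A M N := \sum_(j <- F M) \sum_(i <- F N)
  #|` F M|%:R^-1 * #|` F N|%:R^-1 * K j i.
apply: (average_recurs_above (A := A)).
- move=> M N; rewrite /A exchange_big /=; apply: eq_bigr => j _.
  by apply: eq_bigr => i _; rewrite /K setIC [_^-1 * _^-1]mulrC.
- move=> N; apply: (@le_trans _ _ (\sum_(j <- F N) \sum_(i <- F N)
      #|` F N|%:R^-1 * #|` F N|%:R^-1)).
    apply: ler_sum => j _; apply: ler_sum => i _.
    by rewrite ler_piMr// ?K1// mulr_ge0// invr_ge0 ltW.
  by under eq_bigr do rewrite -mulr_sumr avg1 mulr1; rewrite avg1.
- move=> s.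
  pose w (p : nat * I) : R := #|` F p.1|%:R^-1.
  have := sum_measureI_ge [seq (N, i) | N <- s, i <- F N] w
    (fun p => mE p.2) (fun p => muE p.2).
  rewrite !big_allpairs_dep /w /=.
  rewrite (eq_bigr (fun _ => 1)) => [|N _]; last exact: avg1.
  rewrite big_const_seq count_predT iter_addr_0 => /le_trans; apply.
  rewrite le_eqVlt; apply/orP; left; apply/eqP; apply: eq_bigr => M _.
  under eq_bigr => j _ do rewrite big_allpairs_dep.
  by rewrite exchange_big.
move=> M.
(* A finite convex combination of the sequences tending to 0. *)
have -> : (fun N => A M N - (\sum_(i <- F N) a i) / #|` F N|%:R) =
    (fun N => \sum_(j <- F M) #|` F M|%:R^-1 *
       ((\sum_(i <- F N) K j i) / #|` F N|%:R
        - (\sum_(i <- F N) a i) / #|` F N|%:R)).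
  apply/funext => N; under [RHS]eq_bigr do rewrite mulrBr.
  rewrite big_split /= sumrN -mulr_suml avg1 mul1r; congr (_ - _).
  apply: eq_bigr => j _; rewrite mulrA mulr_sumr mulr_suml.
  by apply: eq_bigr => i _; ring.
rewrite [X in _ --> X](_ : 0 = \sum_(j <- F M) #|` F M|%:R^-1 * 0); last first.
  by rewrite big1// => j _; rewrite mulr0.
apply: cvg_big => [|j _]; first exact: add_continuous.
by apply: cvgM; [exact: cvg_cst|exact: shift].
Qed.

(** * Correlations along almost invariant sets *)

(** The sum over the image and the sum over A share the terms of their
    intersection, and the other terms are at most 1 in absolute value. *)
Lemma sum_image_approx (R : realType) (G : choiceType) (a : G -> R)
    (phi : G -> G) (A : {fset G}) : injective phi ->
  (forall g, 0 <= a g <= 1) ->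
  `|\sum_(g <- A) a (phi g) - \sum_(g <- A) a g| <=
  #|` fset_symdiff [fset phi g | g in A]%fset A|%:R.
Proof.
move=> phi_inj a01; set B := [fset phi g | g in A]%fset.
have -> : \sum_(g <- A) a (phi g) = \sum_(g <- B) a g.
  by rewrite big_imfset //= => x y _ _; exact: phi_inj.
have sumD (C D : {fset G}) : \sum_(g <- C) a g =
    \sum_(g <- (C `&` D)%fset) a g + \sum_(g <- (C `\` D)%fset) a g.
  rewrite (big_fsetID _ (mem D))/=; congr (_ + _); apply: eq_fbigl => x.
    by rewrite !inE.
  by rewrite !inE andbC.
have bound (C : {fset G}) : 0 <= \sum_(g <- C) a g <= #|` C|%:R.
  apply/andP; split; first by apply: sumr_ge0 => g _; have /andP[] := a01 g.
  have -> : #|` C|%:R = \sum_(g <- C) 1 :> R.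
    by rewrite big_const_seq count_predT iter_addr_0.
  by apply: ler_sum => g _; have /andP[] := a01 g.
rewrite (sumD B A) (sumD A B) fsetIC /fset_symdiff.
have : #|` ((B `\` A) `|` (A `\` B))%fset|%:R =
    #|` (B `\` A)%fset|%:R + #|` (A `\` B)%fset|%:R :> R.
  rewrite cardfsU -natrD.
  suff -> : ((B `\` A) `&` (A `\` B) = fset0)%fset by rewrite cardfs0 subn0.
  by apply/fsetP => x; rewrite !inE; case: (x \in A); case: (x \in B).
move=> ->; rewrite ler_norml.
have /andP[] := bound (B `\` A)%fset; have /andP[] := bound (A `\` B)%fset.
by lra.
Qed.

Lemma Folner_shift_average (R : realType) (G : choiceType)
    (F : nat -> {fset G}) (phi : G -> G) (a : G -> R) :
  (forall N, F N != fset0) -> injective phi -> (forall g, 0 <= a g <= 1) ->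
  #|` fset_symdiff [fset phi g | g in F N]%fset (F N)|%:R / #|` F N|%:R
    @[N --> \oo] --> (0 : R) ->
  (\sum_(g <- F N) a (phi g)) / #|` F N|%:R - (\sum_(g <- F N) a g) / #|` F N|%:R
    @[N --> \oo] --> (0 : R).
Proof.
move=> F0 phi_inj a01 small; apply/norm_cvg0P.
apply: squeeze_cvgr (cvg_cst 0) small; apply: nearW => N.
have cardF0 : 0 < #|` F N|%:R :> R by rewrite ltr0n cardfs_gt0.
rewrite normr_ge0 -mulrBl normrM [X in _ * X]gtr0_norm ?invr_gt0//.
by rewrite ler_pM2r ?invr_gt0//; exact: sum_image_approx.
Qed.

(** Write a g for the measure of the intersection of Y and its preimage under
    S g. The correlations of the preimages of Y under S h and S g are a (g h^-1);
    under S h^-1 and S g^-1 they are a (g^-1 h), which is a (h^-1 g) because a is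
    invariant under inversion. Thus one family of translates of Y has a shifted
    on the right as its correlations, the other has a shifted on the left, and
    the averages over F N absorb shifts on the side where F N is almost
    invariant. *)
Lemma diagonal_recurrence (R : realType) (G : groupType) (F : nat -> {fset G})
    (d : measure_display) (X : measurableType d) (mu : probability X R)
    (S : G -> X -> X) (Y : set X) :
  left_Folner R F \/ right_Folner R F ->
  measure_preserving_action mu S -> measurable Y ->
  forall (b : R) (n : nat), b < fine (mu Y) ^+ 2 ->
  exists2 N, (n <= N)%N &
    b < (\sum_(g <- F N) fine (mu (Y `&` S g @^-1` Y))) / #|` F N|%:R.
Proof.
move=> folF [S1 SM mS pS] mY.
have mSY g : measurable (S g @^-1` Y).
  by rewrite -[_ @^-1` _]setTI; exact: mS.
pose a g := fine (mu (Y `&` S g @^-1` Y)).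
have a01 g : 0 <= a g <= 1.
  rewrite /a fine_ge0//= -[leRHS]/(fine 1%E) fine_le ?probability_le1
    ?fin_num_measure//; exact: measurableI.
have muSI g h : fine (mu (S g @^-1` Y `&` S h @^-1` Y)) = a (h * g^-1)%g.
  rewrite /a -(pS g (Y `&` _)); last exact: measurableI.
  rewrite preimage_setI; congr (fine (mu (_ `&` _))); apply/seteqP.
  by split=> x /=; rewrite -SM mulgVK.
have aV g : a g^-1%g = a g.
  by rewrite -[g in RHS]mulg1 -invg1 -muSI setIC muSI mul1g.
case: folF => [[F0 folF]|[F0 folF]].
- apply: (averages_recur (mu := mu) (E := fun g => S g^-1%g @^-1` Y)) => // [g|h].
    by rewrite pS.
  under eq_cvg => N.
    under eq_bigr do rewrite muSI -aV invgM !invgK.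
  over.
  exact: (Folner_shift_average F0 (mulgI _) a01 (folF h^-1%g)).
- apply: (averages_recur (mu := mu) (E := fun g => S g @^-1` Y)) => // [g|h].
    by rewrite pS.
  under eq_cvg => N.
    under eq_bigr do rewrite muSI.
  over.
  exact: (Folner_shift_average F0 (mulIg _) a01 (folF h^-1%g)).
Qed.

(** * From averaged measures to density at a point *)

Lemma limn_einf_le_frequently (R : realType) (u : nat -> \bar R) (c : R) :
  (forall (b : R) (n : nat), c < b ->
     exists2 N, (n <= N)%N & (u N < b%:E)%E) ->
  (limn_einf u <= c%:E)%E.
Proof.
move=> freq; rewrite limn_einf_lim; apply: lime_le; first exact: is_cvg_einfs.
apply: nearW => n; apply/lee_addgt0Pr => e e0.
have ce : c < c + e by rewrite ltrDl.
have [N nN uN] := freq _ n ce.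
by apply: le_trans (ltW uN); apply: ereal_inf_lbound; exists N.
Qed.

(** If the integrals exceed every b < c infinitely often, then so does some
    f N x in the limit, and x may be chosen off any null set: otherwise the
    limit superior g is below c almost everywhere, while Fatou's lemma applied
    to 1 - f N bounds the integral of the positive function c - g by 0. *)
Lemma ex_limn_esup_ge (R : realType) (d : measure_display)
    (X : measurableType d) (mu : probability X R) (f : nat -> X -> R)
    (Z : set X) (c : R) :
  (forall N, mu.-integrable setT (EFin \o f N)) ->
  (forall N x, 0 <= f N x <= 1) -> mu.-negligible Z ->
  (forall (b : R) (n : nat), b < c ->
     exists2 N, (n <= N)%N & b < \int[mu]_x f N x) ->
  exists2 x, ~ Z x & (c%:E <= limn_esup (fun N => (f N x)%:E))%E.
Proof.
move=> intf f01 [Z' [mZ' muZ' ZZ']] freq; apply: contrapT => /forall2NP noX.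
pose g x := limn_esup (fun N => (f N x)%:E).
have mf N : measurable_fun setT (f N).
  by apply/measurable_EFinP; exact: measurable_int (intf N).
have mC := measurableC mZ'.
have g_lt x : (~` Z') x -> (g x < c%:E)%E.
  by move=> Z'x; case: (noX x) => [/contrapT/ZZ'//|/negP]; rewrite -ltNge.
have muC : mu (~` Z') = 1%E.
  by rewrite probability_setC// muZ' sube0.
have mEf N : measurable_fun (~` Z') (EFin \o f N).
  exact: measurable_funTS (measurable_int _ (intf N)).
have mg : measurable_fun (~` Z') g by exact: measurable_fun_limn_esup.
have h0 N x : (~` Z') x -> (0 <= (1 - f N x)%:E)%E.
  by move=> _; rewrite lee_fin subr_ge0; have /andP[] := f01 N x.
have mh N : measurable_fun (~` Z') (fun x => (1 - f N x)%:E).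
  by apply/measurable_EFinP; apply: measurable_funB => //; exact: measurable_funTS.
have int1 : mu.-integrable setT (EFin \o cst (1 : R)).
  exact: finite_measure_integrable_cst.
have int1f N : mu.-integrable setT (fun x => (1 - f N x)%:E).
  rewrite (_ : (fun x => _) = (fun x => 1%:E - (f N x)%:E)%E)//.
  apply: (integrableB measurableT int1 (intf N)).
(* Fatou's lemma for the nonnegative functions 1 - f N; enlarging the domain
   of integration back to X recovers the integrals of the f N. *)
have intfatou : (\int[mu]_(x in ~` Z') (1%:E - g x) <= (1 - c)%:E)%E.
  have gN x : limn_einf (fun N => (1 - f N x)%:E) = (1%:E - g x)%E.
    by rewrite -limn_einfN -limn_einf_shift.
  under eq_integral do rewrite -gN.
  apply: le_trans (fatou mu mC mh h0) _.
  apply: limn_einf_le_frequently => b n cb.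
  have bc : 1 - b < c by lra.
  have [N nN bN] := freq _ n bc.
  exists N => //.
  have mh' : measurable_fun setT (fun x => (1 - f N x)%:E).
    by apply/measurable_EFinP; exact: measurable_funB.
  apply: (@le_lt_trans _ _ (\int[mu]_x (1 - f N x)%:E)%E).
    apply: ge0_subset_integral => // x _.
    by rewrite lee_fin subr_ge0; have /andP[] := f01 N x.
  rewrite -(fineK (integrable_fin_num measurableT (int1f N))) lte_fin.
  rewrite -[ltLHS]/(\int[mu]_x (1 - f N x)) RintegralB// Rintegral_cst//.
  rewrite [X in fine X](_ : _ = 1%E); last exact: probability_setT.
  by rewrite /=; lra.
have g1 x : (g x <= 1%:E)%E.
  rewrite /g limn_esup_lim; apply: lime_le; first exact: is_cvg_esups.
  apply: nearW => n; apply: ge_ereal_sup => _ [N _ <-].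
  by rewrite lee_fin; have /andP[] := f01 N x.
(* Only now is c <= 1 known, which lets 1 - g be split into two nonnegative
   parts, 1 - c and c - g. *)
have c1 : 0 <= 1 - c.
  rewrite -lee_fin; apply: le_trans intfatou; apply: integral_ge0 => x _.
  by rewrite sube_ge0 ?g1 ?orbT.
have mk : measurable_fun (~` Z') (fun x => c%:E - g x)%E.
  by apply: emeasurable_funB => //; exact: measurable_cst.
have k0 x : (~` Z') x -> (0 <= c%:E - g x)%E.
  by move=> /g_lt; rewrite sube_ge0 ?orbT// => /ltW.
have split1 x : (~` Z') x -> (1%:E - g x = (1 - c)%:E + (c%:E - g x))%E.
  move=> _; rewrite addeA -EFinD; congr (_%:E - _)%E; ring.
have : (\int[mu]_(x in ~` Z') (c%:E - g x) <= 0)%E.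
  move: intfatou; rewrite (eq_integral (fun x => (1 - c)%:E + (c%:E - g x))%E).
    rewrite ge0_integralD//.
    rewrite integral_cst// [X in (_ * X)%E](_ : _ = 1%E) ?mule1//.
    by rewrite -[leRHS]adde0 leeD2lE.
  by move=> x; rewrite inE; exact: split1.
move=> int0.
have /(ae_eq_integral_abs mu mC mk) [W [mW muW CW]] :
    (\int[mu]_(x in ~` Z') `|c%:E - g x| = 0)%E.
  apply/eqP; rewrite eq_le integral_ge0 ?andbT//.
  rewrite (eq_integral (fun x => c%:E - g x)%E)// => x; rewrite inE => Z'x.
  by rewrite gee0_abs// k0.
have : (mu (~` Z') <= mu W)%E.
  apply: le_measure; rewrite ?inE// => x Z'x; apply: CW => /= /(_ Z'x) k_eq0.
  by have := g_lt _ Z'x; rewrite -sube_gt0 k_eq0 ltxx.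
by rewrite muC muW lee_fin ler10.
Qed.

(** The densities of the sets of g such that D g contains x are the values at x
    of the averages of the indicators of the D g, whose integrals are the
    averages of the measures of the D g. *)
Lemma ex_upper_density_ge (R : realType) (G : groupType) (F : nat -> {fset G})
    (d : measure_display) (X : measurableType d) (mu : probability X R)
    (D : G -> set X) (Z : set X) (c : R) :
  (forall N, F N != fset0) -> (forall g, measurable (D g)) ->
  mu.-negligible Z ->
  (forall (b : R) (n : nat), b < c -> exists2 N, (n <= N)%N &
     b < (\sum_(g <- F N) fine (mu (D g))) / #|` F N|%:R) ->
  exists2 x, ~ Z x & (c%:E <= upper_density R F [set g | D g x])%E.
Proof.
move=> F0 mD Z0 freq.
pose f N x : R := \sum_(g <- F N) #|` F N|%:R^-1 * \1_(D g) x.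
have cardF0 N : 0 < #|` F N|%:R :> R by rewrite ltr0n cardfs_gt0.
have fE N x : f N x =
    #|` [fset g in F N | g \in [set g | D g x]]%fset|%:R / #|` F N|%:R.
  rewrite /f -mulr_sumr mulrC; congr (_ / _).
  rewrite card_fset_sum1 natr_sum big_fset /= [RHS]big_mkcond /=.
  apply: eq_bigr => h _; rewrite indicE.
  have -> : (x \in D h) = (h \in [set g | D g x]) by apply/idP/idP; rewrite !inE.
  by case: ifP.
have f01 N x : 0 <= f N x <= 1.
  rewrite fE ler_pdivrMr// mul1r divr_ge0 ?ler0n//= ler_nat.
  by apply: fsubset_leq_card; apply/fsubsetP => h; rewrite !inE => /andP[].
have [|b n bc|x Zx cx] := ex_limn_esup_ge (c := c) _ f01 Z0.
- by move=> N; exact: integrable_weighted_indic.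
- have [N nN bN] := freq b n bc; exists N => //.
  by rewrite Rintegral_weighted_indic// -mulr_sumr mulrC.
exists x => //; apply: (le_trans cx); rewrite le_eqVlt; apply/orP; left.
by apply/eqP; congr limn_esup; apply/funext => N; rewrite fE.
Qed.

(** * Sections of the action of the product group *)

Lemma measureI_image (R : realType) (K : groupType) (d : measure_display)
    (X : measurableType d) (mu : probability X R) (T : K -> X -> X)
    (Y : set X) (k : K) :
  measure_preserving_action mu T -> measurable Y ->
  mu (Y `&` T k @` Y) = mu (Y `&` T k @^-1` Y).
Proof.
move=> [T1 TM mT pT] mY.
have TK l x : T l^-1%g (T l x) = x by rewrite -TM mulVg T1.
have TVK l x : T l (T l^-1%g x) = x by rewrite -TM mulgV T1.
have imE : T k @` Y = T k^-1%g @^-1` Y.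
  apply/seteqP; split=> x /= => [[y Yy <-]|Yx]; first by rewrite TK.
  by exists (T k^-1%g x).
have mIm : measurable (T k @` Y).
  by rewrite imE -[_ @^-1` _]setTI; exact: mT.
rewrite -(pT k); last exact: measurableI.
rewrite preimage_setI imE setIC; congr (mu (_ `&` _)).
by apply/seteqP; split=> x /=; rewrite TK.
Qed.

Lemma negligible_bigcup_countable (R : realType) (I : Type)
    (d : measure_display) (X : measurableType d) (mu : {measure set X -> \bar R})
    (C : I -> set X) :
  countable [set: I] -> (forall i, mu.-negligible (C i)) ->
  mu.-negligible (\bigcup_i C i).
Proof.
move=> /countable_injP[f finj] C0.
have -> : \bigcup_i C i = \bigcup_n \bigcup_(i in [set i | f i = n]) C i.
  apply/seteqP; split=> x [i _]; first by exists (f i) => //; exists i.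
  by move=> [k _ Ckx]; exists k.
apply: negligible_bigcup => n.
have [[i fi]|nof] := pselect (exists i, f i = n).
  apply: negligibleS (C0 i) => x [k /= fk].
  by rewrite (finj k i) ?inE//= fk fi.
rewrite (_ : \bigcup_(i in _) C i = set0); first exact: negligible_set0.
by rewrite bigcup0// => i /= fi; case: nof; exists i.
Qed.

Theorem corollary1p15 (R : realType) (G : groupType)
  (countableG : countable_group G) (amenableG : amenable R G)
  (F : nat -> {fset G}) (folnerF : left_Folner R F \/ right_Folner R F)
  (d : measure_display) (X : measurableType d) (mu : probability X R)
  (T : G * G -> X -> X) (mpT : measure_preserving_action mu T)
  (Y : set X) (measurableY : measurable Y) :
  exists B : set G,
    (mu Y ^+ 2 <= upper_density R F B)%E /\
    B `*` B `<=` [set gh : G * G | (0 < mu (Y `&` T gh @` Y))%E].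
Proof.
have [T1 TM mT pT] := mpT.
have F0 N : F N != fset0 by case: folnerF => -[].
have mTY k : measurable (T k @^-1` Y).
  by rewrite -[_ @^-1` _]setTI; exact: mT.
(* T (g, h) maps T (g^-1, 1) x to T (1, h) x: a point of C g h is seen in Y
   through two maps, of which one only involves g and the other only h. *)
pose C g h := T (g^-1, 1)%g @^-1` Y `&` T (1, h)%g @^-1` Y.
have mC g h : measurable (C g h) by exact: measurableI.
have muC g h : mu (C g h) = mu (Y `&` T (g, h) @^-1` Y).
  rewrite -(pT (g^-1, 1)%g (Y `&` _)); last exact: measurableI.
  rewrite preimage_setI; congr (mu (_ `&` _)); apply/seteqP.
  have gh : ((g, h) * (g^-1, 1) = (1, h))%g.
    by congr (_, _); rewrite /= ?mulgV ?mulg1.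
  by split=> x /=; rewrite -TM gh.
have mpS : measure_preserving_action mu (fun g => T (g, g)).
  split=> [x|g h x|g|g A mA]; first exact: (T1 x).
  - exact: (TM (g, g) (h, h)).
  - exact: mT.
  - exact: pT.
have countG : countable [set: G] by rewrite (eq_countable countableG).
pose N g h := if mu (C g h) == 0%E then C g h else set0.
have N0 g h : mu.-negligible (N g h).
  rewrite /N; case: eqP => [C0|_]; last exact: negligible_set0.
  exact/negligibleP.
have Z0 : mu.-negligible (\bigcup_g \bigcup_h N g h).
  by do 2! [apply: negligible_bigcup_countable => // ?].
have [|x Zx Bx] :=
    ex_upper_density_ge (c := fine (mu Y) ^+ 2) F0 (fun g => mC g g) Z0.
  move=> b n bY.
  have [M nM bM] := diagonal_recurrence folnerF mpS measurableY n bY.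
  by exists M => //; under eq_bigr do rewrite muC.
exists [set g | C g g x]; split.
  by rewrite -[mu Y]fineK ?fin_num_measure// -EFin_expe.
move=> [g h] [/= [Ygx _] [_ Yhx]].
rewrite measureI_image// -muC lt0e measure_ge0 andbT.
by apply/eqP => C0; apply: Zx; exists g => //; exists h; rewrite /N ?C0 ?eqxx.
Qed.
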